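(* There exist an irrational number $\alpha$ and a continuous function $\phi:\mathbb{R}\to\mathbb{R}$ with $\phi(1)-\phi(0)\in\mathbb{Z}$ and $\deg(\phi)=0$ such that the system $(X,T)$, where $X=\mathbb{T}^2$ and $$T(x,y)=(x+\alpha \ (\mathrm{mod}\ 1),\ \phi(x)+y\ (\mathrm{mod}\ 1)),\qquad (x,y)\in[0,1)\times[0,1),$$ is minimal, distal, not equicontinuous, and uniformly rigid.
   Context: $\mathbb{T}^1=\mathbb{R}/\mathbb{Z}$ is identified with $[0,1)$, and $\mathbb{T}^2=\mathbb{T}^1\times\mathbb{T}^1$. $\deg(\phi)$ is the degree of the circle map $x\mapsto\phi(x)\ (\mathrm{mod}\ 1)$ induced by $\phi$, i.e. $\deg(\phi)=\phi(1)-\phi(0)$. For a continuous surjective map $T$ of a compact metric space $(X,d)$: $(X,T)$ is minimal if every forward orbit is dense; distal if $x=y$ whenever there is $n_i\to+\infty$ with $d(T^{n_i}x,T^{n_i}y)\to0$; equicontinuous if for each $x$ and $\varepsilon>0$ there is $\delta>0$ with $\mathrm{diam}\,T^n(B(x,\delta))<\varepsilon$ for all $n\ge0$; uniformly rigid if there is a sequence of positive integers $m_i\to\infty$ with $T^{m_i}\to\mathrm{id}$ uniformly. *)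

(* Defs.v *)
From HB Require Import structures.
From mathcomp Require Import all_boot all_order all_algebra lra.
From mathcomp Require Import all_classical all_reals all_analysis.

Set Implicit Arguments.
Unset Strict Implicit.
Unset Printing Implicit Defensive.

Import Order.TTheory GRing.Theory Num.Theory.
Import numFieldNormedType.Exports.

Local Open Scope classical_set_scope.
Local Open Scope ring_scope.

(* The library's product pseudometric (balls are products of balls) comes from
   the max distance. *)
Section product_metric.
Context {R : realType} {M N : metricType R}.
Implicit Types p q : M * N.

Let dist p q : R := Num.max (mdist p.1 q.1) (mdist p.2 q.2).

Let dist_ge0 p q : 0 <= dist p q.
Proof. by rewrite le_max mdist_ge0. Qed.

Let dist_positivity p q : dist p q = 0 -> p = q.
Proof.
case: p q => [a b] [c d] /eqP; rewrite eq_le ge_max => /andP[/andP[/= h1 h2] _].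
congr pair; apply: mdist_positivity; apply/eqP;
  by rewrite eq_le mdist_ge0 andbT.
Qed.

Let ballE p e : ball p e = [set q | dist p q < e].
Proof.
apply/seteqP; split=> [[c d]|[c d]] /=; rewrite /ball /= /prod_ball.
  by move=> []; rewrite !ballEmdist /= /dist gt_max /= => -> ->.
by rewrite !ballEmdist /dist gt_max /= => /andP[].
Qed.

HB.instance Definition _ := PseudoMetric_isMetric.Build R (M * N)%type
  dist_ge0 dist_positivity ballE.

End product_metric.

(* The circle R/Z, identified with [0, 1). *)
Record torus1 (R : realType) := Torus1 {
  torus1_val : R;
  torus1P : 0 <= torus1_val < 1 }.

HB.instance Definition _ (R : realType) := [isSub for @torus1_val R].
HB.instance Definition _ (R : realType) := [Choice of torus1 R by <:].

(* The quotient metric of R/Z: the distance from x - y to the nearest integer. *)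
Section torus1_metric.
Context {R : realType}.
Implicit Types x y z : torus1 R.

Let dist x y : R := Num.min `|val x - val y| (1 - `|val x - val y|).

Let distxx x : dist x x = 0.
Proof. by rewrite /dist subrr normr0 subr0; apply/min_idPl. Qed.

Let val_itv x : 0 <= val x < 1.
Proof. exact: torus1P. Qed.

Let dist_positivity x y : dist x y = 0 -> x = y.
Proof.
rewrite /dist => h; apply: val_inj; move: (val_itv x) (val_itv y) h.
move: (val x) (val y) => a b /andP[a0 a1] /andP[b0 b1]; rewrite minElt.
by case: (ger0P (a - b)) => ?; case: ifP => ? ?; lra.
Qed.

Let dist_sym x y : dist x y = dist y x.
Proof. by rewrite /dist distrC. Qed.

Let dist_triangle y x z : dist x z <= dist x y + dist y z.
Proof.
move: (val_itv x) (val_itv y) (val_itv z); rewrite /dist !minElt.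
move: (val x) (val y) (val z) => a b c /andP[a0 a1] /andP[b0 b1] /andP[c0 c1].
case: (ger0P (a - c)) => ?; case: (ger0P (a - b)) => ?;
  case: (ger0P (b - c)) => ?; do 3 case: ltP => ?; lra.
Qed.

HB.instance Definition _ := isMetric.Build R (torus1 R)
  distxx dist_positivity dist_sym dist_triangle.

End torus1_metric.

Lemma mod1_subproof (R : realType) (t : R) :
  0 <= t - (Num.floor t)%:~R < 1.
Proof.
by have /andP[h1 h2] := mem_rg1_floor t; apply/andP; split; lra.
Qed.

Definition mod1 (R : realType) (t : R) : torus1 R := Torus1 (mod1_subproof t).

(* The degree of the circle map x |-> phi x (mod 1), meaningful when
   phi 1 - phi 0 is an integer. *)
Definition degree (R : realType) (phi : R -> R) : R := phi 1 - phi 0.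

Definition skew_product (R : realType) (alpha : R) (phi : R -> R)
    (p : torus1 R * torus1 R) : torus1 R * torus1 R :=
  (mod1 (val p.1 + alpha), mod1 (phi (val p.1) + val p.2)).

Section dynamics.
Context {R : realType} {X : metricType R}.
Implicit Types (T : X -> X) (A : set X).

Definition dynamical_system T :=
  [/\ compact [set: X], continuous T & set_surj [set: X] [set: X] T].

Definition minimal T := forall x, dense (range (fun n => iter n T x)).

Definition distal T := forall x y,
  (exists2 n_ : nat -> nat, n_ @ \oo --> \oo &
     (fun i => mdist (iter (n_ i) T x) (iter (n_ i) T y)) @ \oo --> (0 : R)) ->
  x = y.

Definition diam A : \bar R :=
  ereal_sup [set (mdist p.1 p.2)%:E | p in A `*` A].

(* The library's [equicontinuous] is the entourage form of this notion. *)
Definition equicontinuous_system T := forall x (e : R), 0 < e ->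
  exists2 d : R, 0 < d &
    forall n, (diam (iter n T @` ball x d) < e%:E)%E.

Definition uniformly_rigid T := exists m : nat -> nat,
  [/\ forall i, (0 < m i)%N, m @ \oo --> \oo &
      {uniform, (fun i => iter (m i) T) @ \oo --> (id : X -> X)}].

End dynamics.

(* Main.v *)
(** Take alpha = sum_k 1/q_k with q_k = 2^(4^k), and let phi be the formal
coboundary sum_k (c(q_k (x + alpha)) - c(q_k x)), where c is twice the distance
to the nearest integer.  The series converges because q_k alpha is extremely
close to an integer, and the n-th Birkhoff sum of phi is
sum_k (c(q_k (x + n alpha)) - c(q_k x)).  For n = q_m all terms are small, hence
uniform rigidity.  Multiples n of q_m that are at most 2 q_{m+1} bring n alpha
close to any prescribed w modulo 1, up to an error far below 1/q_m, while the
terms k > m stay negligible; moving w by at most 1/q_m hardly affects the terms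
k < m but lets the m-th one run through all of [0, 1].  This gives minimality,
and, applied to the two starting points 0 and 1/(4 q_m), the failure of
equicontinuity.  Distality holds since T acts by isometries on the fibres over a
rotation. *)
Require Import Defs.
From mathcomp Require Import all_boot all_order all_algebra.
From mathcomp Require Import all_classical all_reals all_analysis.
From mathcomp Require Import lra ring zify.
Import Order.TTheory GRing.Theory Num.Theory.
Import numFieldNormedType.Exports.

Set Implicit Arguments.
Unset Strict Implicit.
Unset Printing Implicit Defensive.

Local Open Scope classical_set_scope.
Local Open Scope ring_scope.

(** * Distance to the nearest integer *)

Section dist_to_int.
Context {R : realType}.
Implicit Types (a b x : R) (k : int).

(* The distance from x to the nearest integer. *)
Definition dZ x : R := `|x - (Num.floor (x + 2^-1))%:~R|.

Lemma dZ_attained x : exists k, dZ x = `|x - k%:~R|.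
Proof. by exists (Num.floor (x + 2^-1)). Qed.

Lemma dZ_le_half x : dZ x <= 2^-1.
Proof.
rewrite /dZ; have /andP[h1 h2] := mem_rg1_floor (x + 2^-1).
by rewrite ler_norml; apply/andP; split; lra.
Qed.

(** The rounded integer is within 1/2 of [x], and every other integer is at distance at least 1 from
    it. *)
Lemma dZ_le x k : dZ x <= `|x - k%:~R|.
Proof.
have := dZ_le_half x; rewrite /dZ; set j := Num.floor _ => hj.
have [->//|jk] := eqVneq j k.
have : 1 <= `|j%:~R - k%:~R| :> R.
  by rewrite -intrB -intr_norm (_ : 1 = 1%:~R) // ler_int -gtz0_ge1 normr_gt0 subr_eq0.
have := ler_distD x j%:~R k%:~R; rewrite (distrC j%:~R x); lra.
Qed.

Lemma dZ_ge0 x : 0 <= dZ x. Proof. exact: normr_ge0. Qed.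

Lemma dZ_le_norm x : dZ x <= `|x|.
Proof. by have := dZ_le x 0; rewrite subr0. Qed.

Lemma dZ_int k : dZ k%:~R = 0.
Proof. by apply/eqP; rewrite eq_le dZ_ge0 andbT (le_trans (dZ_le _ k))// subrr normr0. Qed.

Lemma dZN x : dZ (- x) = dZ x.
Proof.
have H y : dZ (- y) <= dZ y.
  have [k ->] := dZ_attained y; apply: (le_trans (dZ_le _ (- k))).
  by rewrite intrN -opprD normrN.
by apply/eqP; rewrite eq_le H -{1}(opprK x) H.
Qed.

Lemma dZD a b : dZ (a + b) <= dZ a + dZ b.
Proof.
have [j ->] := dZ_attained a; have [k ->] := dZ_attained b.
apply: (le_trans (dZ_le _ (j + k))); rewrite intrD.
by rewrite (_ : a + b - _ = (a - j%:~R) + (b - k%:~R)) ?ler_normD//; ring.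
Qed.

Lemma dZC a b : dZ (a - b) = dZ (b - a).
Proof. by rewrite -dZN opprB. Qed.

Lemma dZ_addz x k : dZ (x + k%:~R) = dZ x.
Proof.
have H y j : dZ (y + j%:~R) <= dZ y.
  by apply: (le_trans (dZD _ _)); rewrite dZ_int addr0.
apply/eqP; rewrite eq_le H /= -{1}(addrK k%:~R x) -intrN; exact: H.
Qed.

Lemma dZ_lip a b : `|dZ a - dZ b| <= dZ (a - b).
Proof.
have := dZD (a - b) b; have := dZD (b - a) a; rewrite !subrK (dZC b a).
by move=> ? ?; rewrite ler_norml; apply/andP; split; lra.
Qed.

Lemma dZ_mulrn n x : dZ (n%:R * x) <= n%:R * dZ x.
Proof.
have [k ->] := dZ_attained x; apply: (le_trans (dZ_le _ (n%:Z * k))).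
by rewrite intrM -mulrBr normrM (ger0_norm (ler0n _ n)).
Qed.

Lemma dZ_itv x : 0 <= x <= 1 -> dZ x = Num.min x (1 - x).
Proof.
move=> /andP[x0 x1]; apply/eqP; rewrite eq_le; apply/andP; split.
  rewrite le_min; apply/andP; split.
    by have := dZ_le_norm x; rewrite ger0_norm.
  have := dZ_le x 1; rewrite distrC ger0_norm//; lra.
have [k ->] := dZ_attained x; rewrite ge_min.
have [k0|k1] := leP k 0.
  have : k%:~R <= (0 : R) by rewrite (ler_int _ k 0).
  by move=> ?; rewrite ger0_norm ?lerBrDr; [apply/orP; left|]; lra.
have : (1 : R) <= k%:~R by rewrite (ler_int _ 1 k) -gtz0_ge1.
by move=> ?; rewrite ler0_norm; [apply/orP; right|]; lra.
Qed.

End dist_to_int.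

(** * The circle and the torus through real representatives *)

Section torus.
Context {R : realType}.
Implicit Types (a b x : R).

Lemma mod1_eq x : exists k, val (mod1 x) = x + k%:~R.
Proof. by exists (- Num.floor x); rewrite /= intrN. Qed.

Lemma mod1K (p : torus1 R) : mod1 (val p) = p.
Proof.
apply: val_inj => /=; have /andP[h0 h1] := torus1P p.
by rewrite (floor_def (m:=0)) ?subr0// h0 /=.
Qed.

(** Replaces the minimum in the circle metric by [dZ], so that all later distances are computed on
    real numbers. *)
Lemma mdist_torus1 (p q : torus1 R) : mdist p q = dZ (val p - val q).
Proof.
rewrite /mdist /=.
have /andP[p0 p1] := torus1P p; have /andP[q0 q1] := torus1P q.
have E : dZ (val p - val q) = dZ `|val p - val q|.
  by case: (ger0P (val p - val q)) => // _; rewrite dZN.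
rewrite E dZ_itv// normr_ge0 ler_norml; apply/andP; split; rewrite /= ; lra.
Qed.

Lemma mdist_mod1 a b : mdist (mod1 a) (mod1 b) = dZ (a - b).
Proof.
rewrite mdist_torus1; have [j ->] := mod1_eq a; have [k ->] := mod1_eq b.
by rewrite (_ : _ - _ = (a - b) + (j - k)%:~R) ?dZ_addz// intrB; ring.
Qed.

Lemma mod1_surj (p : torus1 R) : exists2 a, 0 <= a < 1 & p = mod1 a.
Proof. by exists (val p); rewrite ?mod1K //; exact: torus1P. Qed.

Lemma mod1_eqP a b : dZ (a - b) = 0 -> mod1 a = mod1 b.
Proof. by move=> h; apply: mdist_positivity; rewrite mdist_mod1. Qed.

Lemma mdist_pair (p q : torus1 R * torus1 R) :
  mdist p q = Num.max (mdist p.1 q.1) (mdist p.2 q.2).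
Proof. by []. Qed.

Lemma continuous_mod1 : continuous (@mod1 R).
Proof.
move=> x; apply/cvg_ballP => e e0; near=> y.
rewrite ballEmdist /= mdist_mod1; apply: (le_lt_trans (dZ_le_norm _)).
by near: y; exact: (@cvgr_dist_lt _ _ _ (nbhs x) _ id x cvg_id).
Unshelve. all: by end_near. Qed.

Lemma compact_torus1 : compact [set: torus1 R].
Proof.
rewrite (_ : setT = @mod1 R @` `[0, 1]).
  apply: continuous_compact; last exact: segment_compact.
  exact/continuous_subspaceT/continuous_mod1.
apply/seteqP; split => // p _; have [a /andP[a0 a1] ->] := mod1_surj p.
by exists a => //=; rewrite in_itv /= a0 ltW.
Qed.

Lemma compact_torus2 : compact [set: torus1 R * torus1 R].
Proof. by rewrite -setXTT; apply: compact_setX; exact: compact_torus1. Qed.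

End torus.

(** * Series with an explicit tail bound *)

Section nested_sum.
Context {R : realType}.
Implicit Types u w : nat -> R.

(* The sum of the series u as the common point of the nested intervals
   [s_N - w_N, s_N + w_N] around its partial sums, for a telescoping majorant w. *)
Definition nested_sum u w : R :=
  sup (range (fun N => \sum_(k < N) u k - w N)).

(** The bound on [u] makes the lower ends s_N - w_N nondecreasing and the upper ends s_N + w_N
    nonincreasing, so the supremum of the lower ends lies in every interval. *)
Lemma nested_sumP u w N : (forall k, 0 <= w k) ->
  (forall k, `|u k| <= w k - w k.+1) ->
  `|nested_sum u w - \sum_(k < N) u k| <= w N.
Proof.
move=> w0 uw; pose s n := \sum_(k < n) u k.
have sS n : s n.+1 = s n + u n by rewrite /s big_ord_recr.
have lo : {homo (fun n => s n - w n) : m n / (m <= n)%N >-> m <= n}.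
  apply: homo_leq => [//|x y z|n]; first exact: le_trans.
  by rewrite sS; have := uw n; rewrite ler_norml => /andP[]; lra.
have hi : {homo (fun n => - (s n + w n)) : m n / (m <= n)%N >-> m <= n}.
  apply: homo_leq => [//|x y z|n]; first exact: le_trans.
  by rewrite sS; have := uw n; rewrite ler_norml => /andP[]; lra.
have lohi m n : s m - w m <= s n + w n.
  have := lo _ _ (leq_maxl m n); have := hi _ _ (leq_maxr m n).
  have := w0 (maxn m n); lra.
have ub n : ubound (range (fun N => s N - w N)) (s n + w n).
  by move=> _ [m _ <-].
rewrite ler_norml; apply/andP; split.
  have : s N - w N <= nested_sum u w.
    by apply: ub_le_sup; [exists (s 0%N + w 0%N); exact: ub | exists N].
  by rewrite /s; lra.
have : nested_sum u w <= s N + w N by apply: ge_sup => //; exists (s 0%N - w 0%N), 0%N.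
by rewrite /s; lra.
Qed.

End nested_sum.

(** Serves distality: [c] will be a coordinate distance that the iterates preserve. *)
Lemma cvg0_lower_bound (R : realType) (u : nat -> R) (c : R) :
  0 <= c -> (forall i, c <= u i) -> u @ \oo --> 0 -> c = 0.
Proof.
move=> c0 cu u0; apply/eqP; rewrite eq_le c0 andbT.
by apply: (cvgr_to_ge u0); exact: nearW.
Qed.

Lemma mdist_le_diam (R : realType) (X : metricType R) (A : set X) (a b : X) :
  A a -> A b -> ((mdist a b)%:E <= diam A)%E.
Proof. by move=> Aa Ab; apply: ereal_sup_ubound; exists (a, b). Qed.

(** * The frequencies q_k and the rotation number alpha *)

Section construction.
Context {R : realType}.
Implicit Types (a b x y : R) (k m n N : nat).

Definition q k : R := (2 ^ (4 ^ k))%:R.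
Definition v k : R := (q k)^-1.

Lemma qS k : q k.+1 = q k ^+ 4.
Proof. by rewrite /q expnSr expnM natrX. Qed.

Lemma q_ge2 k : 2 <= q k.
Proof. by rewrite /q ler_nat -[X in (X <= _)%N](expn1 2) leq_exp2l// expn_gt0. Qed.

Lemma q_gt0 k : 0 < q k. Proof. by have := q_ge2 k; lra. Qed.

Lemma q_doubling k : 2 * q k <= q k.+1.
Proof.
rewrite qS exprSr ler_pM2r ?q_gt0// (le_trans (q_ge2 k))// ler_eXnr//.
by have := q_ge2 k; lra.
Qed.

Lemma vS k : v k.+1 = v k ^+ 4. Proof. by rewrite /v qS exprVn. Qed.

Lemma v_gt0 k : 0 < v k. Proof. by rewrite invr_gt0 q_gt0. Qed.

Lemma qv k : q k * v k = 1. Proof. by rewrite divff// gt_eqF// q_gt0. Qed.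

Lemma v_le_half k : v k <= 2^-1.
Proof. by rewrite /v lef_pV2 ?posrE ?q_gt0 ?q_ge2. Qed.

(** Lets linear arithmetic compare different powers of [v k]. *)
Lemma v_exprS k n : 0 < v k ^+ n.+1 <= v k ^+ n / 2.
Proof.
by rewrite exprn_gt0 ?v_gt0//= exprSr ler_pM2l ?exprn_gt0 ?v_gt0// v_le_half.
Qed.

Lemma v_small (e : R) : 0 < e -> exists K, forall k, (K <= k)%N -> v k < e.
Proof.
move=> e0; exists (Num.truncn e^-1) => k Kk.
rewrite -(invrK e) /v ltf_pV2 ?posrE ?q_gt0 ?invr_gt0//.
have /andP[_ /lt_le_trans ->//] : (Num.truncn e^-1)%:R <= e^-1 < (Num.truncn e^-1).+1%:R.
  by apply: truncn_itv; rewrite invr_ge0 ltW.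
rewrite ler_nat; apply: (leq_ltn_trans Kk).
by apply: (ltn_trans (ltn_expl k (isT : 1 < 4)%N)); apply: ltn_expl.
Qed.

Definition alpha : R := nested_sum v (fun k => 2 * v k).

Lemma alpha_tail N : `|alpha - \sum_(k < N) v k| <= 2 * v N.
Proof.
apply: (@nested_sumP _ v (fun k => 2 * v k)) => k; first by have := v_gt0 k; lra.
rewrite gtr0_norm ?v_gt0// vS.
by have := v_exprS k 1; have := v_exprS k 2; have := v_exprS k 3; rewrite expr1; lra.
Qed.

(** Every q_k with k <= m divides q_m; the induction step multiplies by q_m^3. *)
Lemma q_partial_sum m : exists z : int, q m * \sum_(k < m.+1) v k = z%:~R.
Proof.
elim: m => [|m [z IH]]; first by exists 1; rewrite big_ord1 qv.
exists (((2 ^ (4 ^ m)) ^ 3)%N%:Z * z + 1).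
rewrite big_ord_recr mulrDr qv intrD intrM -IH; congr (_ + _).
by rewrite -pmulrn natrX qS (exprS _ 3) -/(q m); ring.
Qed.

(** Up to an integer, q_m alpha is q_m times the tail of the series, whose leading term contributes
    q_m v_{m+1} = v_m^3. *)
Lemma alpha_approx m :
  exists z : int, v m ^+ 3 / 2 <= q m * alpha - z%:~R <= 2 * v m ^+ 3.
Proof.
have [z Hz] := q_partial_sum m; exists z; rewrite -Hz -mulrBr.
(* The tail after m + 1 terms gives the upper bound; splitting off one more term gives the lower
   bound. *)
have := alpha_tail m.+1; have := alpha_tail m.+2.
rewrite big_ord_recr /=; set s := \sum_(k < _) _.
rewrite !ler_norml !vS => /andP[h1 _] /andP[_ h2].
have E : v m ^+ 3 = q m * v m ^+ 4 by rewrite (exprS _ 3) mulrA qv mul1r.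
have q0 := q_gt0 m; rewrite E -mulrA (mulrCA 2) !ler_pM2l//.
have := v_exprS m.+1 1; have := v_exprS m.+1 2; have := v_exprS m.+1 3.
by rewrite expr1 vS; lra.
Qed.

Lemma dZ_q_alpha m : dZ (q m * alpha) <= 2 * v m ^+ 3.
Proof.
have [z /andP[h1 h2]] := alpha_approx m; apply: (le_trans (dZ_le _ z)).
rewrite ger0_norm//; apply: le_trans h1; apply: divr_ge0 => //.
by rewrite exprn_ge0// ltW// v_gt0.
Qed.

Lemma irrational_alpha : irrational alpha.
Proof.
move=> /rationalP[a [b ab]].
wlog b0 : a b ab / (0 < b)%N => [H|].
  have [b0|] := posnP b; last exact: H ab.
  (* Division by 0 yields 0, which is also 0/1. *)
  by apply: (H 0 1%N) => //; rewrite ab b0 invr0 mulr0 mul0r.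
have bR0 : 0 < b%:R :> R by rewrite ltr0n.
have [m /(_ m (leqnn m))] := @v_small b%:R^-1 ltac:(by rewrite invr_gt0).
rewrite -(ltr_pM2l bR0) divff ?gt_eqF// => bv.
have [z] := alpha_approx m; have := v_exprS m 1; have := v_exprS m 2; rewrite expr1.
move=> /andP[? ?] /andP[? ?] /andP[h1 h2].
(* If alpha = a/b, this quantity is an integer, yet it lies strictly between 0 and 1 once v_m <
   1/b. *)
have E : b%:R * (q m * alpha - z%:~R) = ((2 ^ (4 ^ m))%:Z * a - b%:Z * z)%:~R.
  rewrite ab intrB !intrM -!pmulrn -/(q m) mulrBr mulrCA (mulrCA b%:R a%:~R).
  by rewrite divff ?gt_eqF// mulr1.
have : 0 < b%:R * (q m * alpha - z%:~R) by rewrite mulr_gt0//; lra.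
have : b%:R * (q m * alpha - z%:~R) < 1.
  by apply: le_lt_trans bv; rewrite ler_pM2l//; lra.
by rewrite E (ltr_int _ _ 1) (ltr_int _ 0); lia.
Qed.

(** * The function phi and its Birkhoff sums *)

Definition transfer N x : R := \sum_(k < N) 2 * dZ (q k * x).

(** The k-th term has Lipschitz constant 2 q_k, and these sum to at most 4 q_m because q at least
    doubles at each step. *)
Lemma transfer_lip m a b : `|transfer m.+1 a - transfer m.+1 b| <= 4 * q m * dZ (a - b).
Proof.
have H k : `|2 * dZ (q k * a) - 2 * dZ (q k * b)| <= 2 * q k * dZ (a - b).
  rewrite -mulrBr normrM ger0_norm// -mulrA ler_pM2l//.
  by apply: (le_trans (dZ_lip _ _)); rewrite -mulrBr dZ_mulrn.
elim: m => [|m IH].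
  rewrite /transfer !big_ord1; apply: (le_trans (H _)).
  by rewrite ler_wpM2r ?dZ_ge0//; have := q_gt0 0; lra.
rewrite /transfer !(big_ord_recr m.+1) /= -!/(transfer _ _).
rewrite opprD addrACA; apply: (le_trans (ler_normD _ _)).
apply: (le_trans (lerD IH (H _))); rewrite -mulrDl ler_wpM2r ?dZ_ge0//.
by have := q_doubling m; lra.
Qed.

Definition phi x : R :=
  nested_sum (fun k => 2 * dZ (q k * (x + alpha)) - 2 * dZ (q k * x))
    (fun k => 8 * v k ^+ 3).

(** The k-th term is at most 2 dZ(q_k alpha) <= 4 v_k^3, hence at most 8 v_k^3 - 8 v_{k+1}^3. *)
Lemma phi_approx N x : `|phi x - (transfer N (x + alpha) - transfer N x)| <= 8 * v N ^+ 3.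
Proof.
rewrite /transfer -sumrB.
apply: (@nested_sumP _ (fun k => _ - _) (fun k => 8 * v k ^+ 3)) => k.
  by rewrite mulr_ge0// exprn_ge0// ltW// v_gt0.
rewrite -mulrBr normrM ger0_norm//.
have := dZ_lip (q k * (x + alpha)) (q k * x).
rewrite -mulrBr (addrC x) addrK => /le_trans /(_ (dZ_q_alpha k)) h.
have := v_exprS k.+1 1; have := v_exprS k.+1 2; have := v_exprS k 3.
rewrite expr1 -vS; lra.
Qed.

(** Measuring the distance by [dZ] yields continuity and 1-periodicity of [phi] at once. *)
Lemma phi_modulus (e : R) : 0 < e ->
  exists2 d, 0 < d & forall a b, dZ (a - b) < d -> `|phi a - phi b| < e.
Proof.
move=> e0; have e32 : 0 < e / 32 by lra.
have [m] := v_small e32.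
move=> /(_ m.+1 (leqnSn _)) vm.
(* The two transfer sums then vary by less than e/2 together, and the two tails add less than
   e/8. *)
have qm := q_gt0 m; exists (e / (16 * q m)); first by rewrite divr_gt0//; lra.
move=> a b; rewrite ltr_pdivlMr; last lra.
have := phi_approx m.+1 a; have := phi_approx m.+1 b.
have := transfer_lip m a b; have := transfer_lip m (a + alpha) (b + alpha).
rewrite (_ : a + alpha - (b + alpha) = a - b); last by ring.
have := v_exprS m.+1 1; have := v_exprS m.+1 2; rewrite expr1 => /andP[? ?] /andP[? ?].
rewrite !ler_norml ltr_norml => /andP[? ?] /andP[? ?] /andP[? ?] /andP[? ?] ?.
by apply/andP; split; lra.
Qed.

Lemma continuous_phi : continuous phi.
Proof.
move=> x; apply/cvgrPdist_lt => e e0; have [d d0 H] := phi_modulus e0.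
near=> y; apply: H; apply: (le_lt_trans (dZ_le_norm _)).
by near: y; exact: (@cvgr_dist_lt _ _ _ (nbhs x) _ id x cvg_id).
Unshelve. all: by end_near. Qed.

Lemma phi_mod1 a b : dZ (a - b) = 0 -> phi a = phi b.
Proof.
move=> ab; apply/eqP; rewrite -subr_eq0 -normr_eq0 eq_le normr_ge0 andbT.
apply/ler_addgt0Pl => e e0; have [d d0 H] := phi_modulus e0.
by rewrite addr0 ltW// H// ab.
Qed.

Definition birkhoff n x : R := \sum_(i < n) phi (x + i%:R * alpha).

(** The first [N] terms telescope along the orbit; the tail error is paid once per step. *)
Lemma birkhoff_approx N n x :
  `|birkhoff n x - (transfer N (x + n%:R * alpha) - transfer N x)| <= n%:R * (8 * v N ^+ 3).
Proof.
elim: n => [|n IH]; first by rewrite /birkhoff big_ord0 !mul0r addr0 subrr subr0 normr0.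
rewrite /birkhoff big_ord_recr /= -/(birkhoff n x).
have := phi_approx N (x + n%:R * alpha).
rewrite -(natr1 n) (_ : x + n%:R * alpha + alpha = x + (n%:R + 1) * alpha); last by ring.
move: IH; rewrite !ler_norml => /andP[? ?] /andP[? ?]; apply/andP; split; lra.
Qed.

(** Each block of q_m steps rotates by the small positive angle [th], so a suitable number of blocks
    reaches [w] modulo 1 with error at most [th]. *)
Lemma birkhoff_steer m (w : R) : exists n, dZ (n%:R * alpha - w) <= v m /\
  forall x, `|birkhoff n x - (transfer m.+1 (x + w) - transfer m.+1 x)| <= 8 * v m.
Proof.
have [z] := alpha_approx m; set th := _ - _ => /andP[th1 th2].
have v0 := v_gt0 m; have vh := v_le_half m; have q0 := q_gt0 m.
have v3 : v m ^+ 3 <= v m / 4.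
  by have := v_exprS m 1; have := v_exprS m 2; rewrite expr1; lra.
have th0 : 0 < th by apply: lt_le_trans th1; rewrite divr_gt0// exprn_gt0.
pose w0 := w - (Num.floor w)%:~R; have /andP[w00 w01] : 0 <= w0 < 1 := mod1_subproof w.
pose j := Num.truncn (w0 / th).
have /andP[] : j%:R <= w0 / th < j.+1%:R by apply: truncn_itv; rewrite divr_ge0// ltW.
rewrite ler_pdivlMr// ltr_pdivrMr// -(natr1 j) => j1 j2.
pose n := (j * 2 ^ (4 ^ m))%N.
have nE : n%:R = j%:R * q m by rewrite /n natrM.
have nw : dZ (n%:R * alpha - w) <= 2 * v m ^+ 3.
  apply: (le_trans (dZ_le _ (j%:Z * z - Num.floor w))).
  rewrite (_ : _ - _ = j%:R * th - w0); last first.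
    by rewrite nE /th /w0 intrB intrM -pmulrn; ring.
  by rewrite ler_norml; apply/andP; split; lra.
exists n; split=> [|x]; first lra.
(* As j th < 1 and th >= v_m^3 / 2, n is at most 2 q_m^4 = 2 q_{m+1}, so the terms k > m stay
   negligible. *)
have hn : n%:R * (8 * v m.+1 ^+ 3) <= 16 * v m ^+ 8.
  rewrite nE vS -exprM (_ : _ * _ = 8 * (j%:R * v m ^+ 11)); last first.
    by rewrite (exprS _ 11) -[in RHS](mul1r (v m ^+ 11)) -(qv m); ring.
  have : j%:R * v m ^+ 3 <= 2 by nra.
  rewrite (exprD _ 3 8); have : 0 <= v m ^+ 8 by rewrite exprn_ge0// ltW.
  nra.
have v8 : v m ^+ 8 <= v m ^+ 2 / 8.
  have := v_exprS m 2; have := v_exprS m 3; have := v_exprS m 4.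
  by have := v_exprS m 5; have := v_exprS m 6; have := v_exprS m 7; lra.
have v2 := v_exprS m 1; rewrite expr1 in v2.
have := birkhoff_approx m.+1 n x; have := transfer_lip m (x + n%:R * alpha) (x + w).
rewrite (_ : x + _ - _ = n%:R * alpha - w); last by ring.
have : q m * dZ (n%:R * alpha - w) <= 2 * v m ^+ 2.
  rewrite (_ : v m ^+ 2 = q m * v m ^+ 3); last by rewrite (exprS _ 2) mulrA qv mul1r.
  by rewrite mulrCA ler_pM2l.
rewrite !ler_norml => ? /andP[? ?] /andP[? ?]; apply/andP; split; nra.
Qed.

(** * The skew product and its iterates *)

Local Notation T := (skew_product alpha phi).

(** Periodicity of [phi] permits arbitrary real representatives, which removes the reductions modulo
    1 from the iterates. *)
Lemma skew_product_mod1 x y :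
  T (mod1 x, mod1 y) = (mod1 (x + alpha), mod1 (y + phi x)).
Proof.
rewrite /skew_product; have [j ->] := mod1_eq x; have [k ->] := mod1_eq y.
congr pair; apply: mod1_eqP.
  by rewrite (_ : _ - _ = j%:~R) ?dZ_int//; ring.
rewrite (phi_mod1 (b := x)); first by rewrite (_ : _ - _ = k%:~R) ?dZ_int//; ring.
by rewrite (_ : _ - _ = j%:~R) ?dZ_int//; ring.
Qed.

Lemma iter_skew_product n x y :
  iter n T (mod1 x, mod1 y) = (mod1 (x + n%:R * alpha), mod1 (y + birkhoff n x)).
Proof.
elim: n => [|n IH]; first by rewrite /birkhoff big_ord0 mul0r !addr0.
rewrite iterS IH skew_product_mod1 /birkhoff big_ord_recr /= addrA.
by rewrite -natr1 mulrDl mul1r addrA.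
Qed.

Lemma pair_mod1 (p : torus1 R * torus1 R) : p = (mod1 (val p.1), mod1 (val p.2)).
Proof. by rewrite !mod1K -surjective_pairing. Qed.

Lemma continuous_skew_product : continuous T.
Proof.
move=> p; apply/cvg_ballP => e e0; have e2 : 0 < e / 2 by lra.
have [d d0 H] := phi_modulus e2; near=> p'.
have : ball p (Num.min d (e / 2)) p'.
  by near: p'; apply: (@nbhsx_ballx R (torus1 R * torus1 R)%type p); rewrite lt_min d0.
rewrite !ballEmdist /= !mdist_pair !gt_max !lt_min !mdist_torus1.
move=> /andP[/andP[pd p2] /andP[_ p2']]; rewrite -!mdist_torus1 !mdist_mod1.
apply/andP; split; first by rewrite opprD addrACA subrr addr0; lra.
rewrite opprD addrACA; apply: (le_lt_trans (dZD _ _)).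
by have := dZ_le_norm (phi (val p.1) - phi (val p'.1)); have := H _ _ pd; lra.
Unshelve. all: by end_near. Qed.

Lemma surj_skew_product : set_surj [set: _] [set: _] T.
Proof.
move=> p _; rewrite /= (pair_mod1 p).
exists (mod1 (val p.1 - alpha), mod1 (val p.2 - phi (val p.1 - alpha))) => //.
by rewrite skew_product_mod1 !subrK.
Qed.

(** * Minimality *)

Lemma transfer_recr m x : transfer m.+1 x = transfer m x + 2 * dZ (q m * x).
Proof. by rewrite /transfer big_ord_recr. Qed.

Lemma skew_product_approach x y x' y' (e : R) : 0 < e -> exists n,
  dZ (x + n%:R * alpha - x') < e /\ dZ (y + birkhoff n x - y') < e.
Proof.
move=> e0; have [j] := @v_small (e / 16) ltac:(lra).
(* The terms k < m are those up to [j]; a shift by at most v_m changes their sum by at most 4 q_j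
   v_m = 4 v_j^3. *)
move=> /(_ j (leqnn j)) je; set m := j.+1.
have qm := q_gt0 m; have vm := v_gt0 m; have vj := v_gt0 j.
have v3 : q j * v m = v j ^+ 3 by rewrite /m vS (exprS _ 3) mulrA qv mul1r.
have vmj : v m <= v j / 4 /\ v j ^+ 3 <= v j / 4.
  have := v_exprS j 1; have := v_exprS j 2; have := v_exprS j 3.
  by rewrite expr1 -vS -/m; split; lra.
(* [W] is the fibre displacement left for the m-th term to supply; only its fractional part [u]
   matters. *)
pose W := y' - y - (transfer m x' - transfer m.+1 x).
have /andP[u0 u1] := mod1_subproof W; set u := W - _ in u0 u1.
(* Aiming at x' + t v_m makes q_m times the target congruent to u/2, which lies in [0, 1/2), so the
   m-th term equals [u]. *)
pose s := u / 2 - q m * x'.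
have /andP[t0 t1] := mod1_subproof s; set t := (s - _) in t0 t1.
have [n [nw nbirk]] := birkhoff_steer m (x' + t * v m - x).
have tv : 0 <= t * v m <= v m by rewrite mulr_ge0 ?(ltW vm)//= ger_pMl// ltW.
exists n; split.
  rewrite (_ : _ - _ = (n%:R * alpha - (x' + t * v m - x)) + t * v m); last by ring.
  apply: (le_lt_trans (dZD _ _)); have := dZ_le_norm (t * v m).
  by rewrite ger0_norm; lra.
have := nbirk x; rewrite (_ : x + (x' + _ - x) = x' + t * v m); last by ring.
rewrite (transfer_recr m (x' + _)) (_ : q m * (x' + t * v m) = q m * x' + t); last first.
  by rewrite mulrDr mulrCA qv mulr1.
have -> : dZ (q m * x' + t) = u / 2.
  rewrite (_ : _ + t = u / 2 + (- Num.floor s)%:~R); last by rewrite intrN /t /s; ring.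
  by rewrite dZ_addz dZ_itv; [apply/min_idPl|]; lra.
have := transfer_lip j (x' + t * v m) x'; rewrite (addrC x') addrK.
have := dZ_le_norm (t * v m); rewrite ger0_norm; last by case/andP: tv.
move=> dt; have dt2 : 4 * q j * dZ (t * v m) <= v j.
  apply: (@le_trans _ _ (4 * (q j * v m))); last by rewrite v3; lra.
  by rewrite -mulrA ler_pM2l// ler_pM2l ?q_gt0//; lra.
rewrite -/m !ler_norml => /andP[? ?] /andP[? ?].
apply: (le_lt_trans (dZ_le _ (- Num.floor W))).
have : u = W - (Num.floor W)%:~R by [].
by rewrite intrN ltr_norml /W => ?; apply/andP; split; lra.
Qed.

Lemma minimal_skew_product : minimal T.
Proof.
move=> p O [p' Op'] oO.
have /nbhs_ballP[e /= e0 eO] : nbhs p' O by exact: open_nbhs_nbhs.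
have [n [h1 h2]] := skew_product_approach (val p.1) (val p.2) (val p'.1) (val p'.2) e0.
exists (iter n T p); split; last by exists n.
apply: eO; rewrite ballEmdist /= mdist_pair (pair_mod1 p) (pair_mod1 p').
by rewrite iter_skew_product /= gt_max !mdist_mod1 dZC h1 dZC h2.
Qed.

(** * Distality *)

Lemma distal_skew_product : distal T.
Proof.
move=> p p' [n_ _]; rewrite (pair_mod1 p) (pair_mod1 p').
move: (val p.1) (val p.2) (val p'.1) (val p'.2) => x y x' y' lim0.
have xx' : mod1 x = mod1 x'.
  (* Both base points undergo the same rotation, so their distance is constant along the orbits. *)
  apply: mod1_eqP; apply: (cvg0_lower_bound (dZ_ge0 _) _ lim0) => i.
  rewrite !iter_skew_product mdist_pair le_max !mdist_mod1.
  by rewrite opprD addrACA subrr addr0 lexx.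
rewrite xx' in lim0 *; congr pair.
(* Over a common base point both fibre coordinates receive the same Birkhoff sum. *)
apply: mod1_eqP; apply: (cvg0_lower_bound (dZ_ge0 _) _ lim0) => i.
rewrite !iter_skew_product mdist_pair le_max !mdist_mod1 orbC.
by rewrite opprD addrACA subrr addr0 lexx.
Qed.

(** * Failure of equicontinuity *)

(* At time n with n alpha near 3/(8 q_m), the term k = m separates the fibre
   coordinates of the points over 0 and over t = 1/(4 q_m) by about 1/2. *)
Lemma skew_product_spread (d : R) : 0 < d ->
  exists t n, `|t| < d /\ 4^-1 <= dZ (birkhoff n 0 - birkhoff n t).
Proof.
move=> d0; have [j] := @v_small (Num.min d (1 / 200)) ltac:(rewrite lt_min d0; lra).
move=> /(_ j (leqnn j)); rewrite lt_min => /andP[jd je]; set m := j.+1.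
have qm := q_gt0 m; have vm := v_gt0 m; have vj := v_gt0 j.
have v3 : q j * v m = v j ^+ 3 by rewrite /m vS (exprS _ 3) mulrA qv mul1r.
have vmj : v m <= v j / 4 /\ v j ^+ 3 <= v j / 4.
  have := v_exprS j 1; have := v_exprS j 2; have := v_exprS j 3.
  by rewrite expr1 -vS -/m; split; lra.
(* Both q_m w = 3/8 and q_m (t + w) = 5/8 are at distance 3/8 from the integers, so the m-th terms
   differ by exactly 2 dZ(q_m t) = 1/2. *)
pose t : R := v m / 4; pose w : R := v m * (3 / 8).
have [n [_ nbirk]] := birkhoff_steer m w.
exists t, n; split; first by rewrite ger0_norm /t; lra.
have := nbirk 0; have := nbirk t; rewrite add0r !(transfer_recr m).
have qt : q m * t = 4^-1 by rewrite /t mulrA qv mul1r.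
have qw : q m * w = 3 / 8 by rewrite /w mulrA qv mul1r.
rewrite (mulrDr (q m) t) qt qw mulr0.
have -> : dZ (4^-1 + 3 / 8 : R) = 3 / 8.
  by rewrite dZ_itv; [rewrite min_r|]; lra.
have -> : dZ (3 / 8 : R) = 3 / 8 by rewrite dZ_itv; [rewrite min_l|]; lra.
have -> : dZ (4^-1 : R) = 4^-1 by rewrite dZ_itv; [rewrite min_l|]; lra.
have -> : dZ (0 : R) = 0 by exact: (dZ_int 0).
have dt : 4 * q j * dZ t <= v j.
  have := dZ_le_norm t; rewrite ger0_norm; last by rewrite /t; lra.
  move=> dt; apply: (@le_trans _ _ (4 * (q j * v m))); last by rewrite v3; lra.
  by rewrite -mulrA ler_pM2l// ler_pM2l ?q_gt0//; rewrite /t in dt *; lra.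
have := transfer_lip j (t + w) w; have := transfer_lip j t 0; rewrite -/m addrK subr0.
rewrite !ler_norml => /andP[? ?] /andP[? ?] /andP[? ?] /andP[? ?].
(* Since v_j < 1/200, the error is below 1/10, which leaves more than 1/4. *)
have : dZ (2^-1 - (birkhoff n 0 - birkhoff n t)) <= 20 * v j.
  by apply: (le_trans (dZ_le_norm _)); rewrite ler_norml; apply/andP; split; lra.
have := dZD (2^-1 - (birkhoff n 0 - birkhoff n t)) (birkhoff n 0 - birkhoff n t); rewrite subrK.
have -> : dZ (2^-1 : R) = 2^-1 by rewrite dZ_itv; [rewrite min_l|]; lra.
lra.
Qed.

Lemma not_equicontinuous_skew_product : ~ equicontinuous_system T.
Proof.
move=> /(_ (mod1 0, mod1 0) 4^-1 ltac:(lra)) [d d0 H].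
have [t [n [td ht]]] := skew_product_spread d0; have := H n; apply/negP.
rewrite -leNgt; pose p0 : torus1 R * torus1 R := (mod1 0, mod1 0).
pose pt : torus1 R * torus1 R := (mod1 t, mod1 0).
apply: (@le_trans _ _ (mdist (iter n T p0) (iter n T pt))%:E).
  rewrite lee_fin /p0 /pt !iter_skew_product mdist_pair le_max !mdist_mod1.
  by rewrite !add0r ht orbT.
apply: mdist_le_diam.
  by exists p0 => //; exact: ballxx.
exists pt => //; rewrite ballEmdist /= mdist_pair !mdist_mod1.
rewrite gt_max subrr (dZ_int 0) d0 andbT sub0r dZN.
exact: le_lt_trans (dZ_le_norm _) td.
Qed.

(** * Uniform rigidity *)

Lemma birkhoff_rigid m x : `|birkhoff (2 ^ (4 ^ m)) x| <= 8 * v m.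
Proof.
have := birkhoff_approx m.+1 (2 ^ (4 ^ m)) x; rewrite -/(q m).
have := transfer_lip m (x + q m * alpha) x; rewrite (addrC x) addrK.
have := v_exprS m 1; have := v_exprS m 2; have := v_exprS m 3.
have := v_exprS m.+1 1; have := v_exprS m.+1 2.
(* Change of the terms k <= m under rotation by q_m alpha. *)
have E1 : 4 * q m * dZ (q m * alpha) <= 8 * v m ^+ 2.
  rewrite (_ : v m ^+ 2 = q m * v m ^+ 3); last by rewrite (exprS _ 2) mulrA qv mul1r.
  by have := dZ_q_alpha m; rewrite -(ler_pM2l (q_gt0 m)); lra.
(* Cost of the terms k > m over q_m steps. *)
have E2 : q m * (8 * v m.+1 ^+ 3) <= 8 * v m ^+ 3.
  rewrite mulrCA ler_pM2l// (exprS _ 2) mulrA {1}vS (exprS _ 3) (mulrA (q m) (v m)) qv mul1r.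
  rewrite ger_pMr ?exprn_gt0 ?v_gt0// exprn_ile1// ?ltW ?v_gt0//.
  by have := v_le_half m.+1; lra.
rewrite expr1 !ler_norml => ? ? ? ? ? /andP[? ?] /andP[? ?]; apply/andP; split; lra.
Qed.

Lemma uniformly_rigid_skew_product : uniformly_rigid T.
Proof.
exists (fun m => 2 ^ (4 ^ m))%N; split.
- by move=> m; rewrite expn_gt0.
- apply/cvgnyPge => N; near=> m; apply: (@leq_trans m).
    by near: m; exact: nbhs_infty_ge.
  by apply: ltnW; apply: (ltn_trans (ltn_expl m (isT : 1 < 4)%N)); apply: ltn_expl.
- move=> P /uniform_nbhs[E [/= entE EP]].
  move: entE; rewrite -(@entourage_from_ballE R (torus1 R * torus1 R)%type) => -[e /= e0 eE].
  have [K HK] := @v_small (e / 16) ltac:(lra).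
  exists K => // m /= /HK vm; apply: EP => p _; apply: eE => /=.
  rewrite ballEmdist /= (pair_mod1 p) iter_skew_product mdist_pair !mdist_mod1 gt_max -/(q m).
  rewrite dZC addrAC subrr add0r dZC addrAC subrr add0r; apply/andP; split.
    apply: (le_lt_trans (dZ_q_alpha m)).
    by have := v_exprS m 1; have := v_exprS m 2; rewrite expr1; lra.
  by apply: (le_lt_trans (dZ_le_norm _)); have := birkhoff_rigid m (val p.1); lra.
Unshelve. all: by end_near. Qed.

End construction.

Theorem mainTheorem8 (R : realType) :
  exists (alpha : R) (phi : R -> R),
    [/\ irrational alpha,
        continuous phi,
        phi 1 - phi 0 \is a Num.int,
        degree phi = 0 &
        let T := skew_product alpha phi in
        [/\ dynamical_system T, minimal T, distal T,
            ~ equicontinuous_system T & uniformly_rigid T]].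
Proof.
have phi01 : degree (@phi R) = 0.
  (* The degree vanishes because [phi] is 1-periodic. *)
  by rewrite /degree (phi_mod1 (b := 0)) ?subrr//= subr0 (dZ_int 1).
exists alpha, phi; split.
- exact: irrational_alpha.
- exact: continuous_phi.
- by rewrite -/(degree phi) phi01.
- exact: phi01.
split.
- split; [exact: compact_torus2 | exact: continuous_skew_product |].
  exact: surj_skew_product.
- exact: minimal_skew_product.
- exact: distal_skew_product.
- exact: not_equicontinuous_skew_product.
- exact: uniformly_rigid_skew_product.
Qed.
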